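(* Let $G$ be a finite simple graph. Then: (i) $\mathrm{v}(I(G\setminus e))\le \mathrm{v}(I(G))+1$ for every $e\in E(G)$. (ii) $\mathrm{v}(I(G))\le \mathrm{v}(I(G\setminus J))+1$ for every clique $J$ of $G$. (iii) If $G$ has at least one edge, then there exists an edge $e\in E(G)$ such that $\mathrm{v}(I(G/e))\le \mathrm{v}(I(G))$.
   Context: $K$ is a field. For a finite simple graph $G$, the edge ideal $I(G)$ is the ideal of the polynomial ring $K[V(G)]$ (variables are the vertices, standard grading) generated by the monomials $xy$ with $\{x,y\}\in E(G)$. For a proper graded ideal $I$ of a polynomial ring $R$ with degree-$d$ component $R_d$, its v-number is $\mathrm{v}(I)=\min\{d\ge 0 : \exists f\in R_d \text{ and } \mathfrak{p}\in\mathrm{Ass}(R/I)\text{ with } (I:f)=\mathfrak{p}\}$. For an edge $e$, $G\setminus e$ is the graph on $V(G)$ obtained by removing only the edge $e$ from $E(G)$. A clique $J$ is a set of pairwise adjacent vertices, and $G\setminus J$ is the induced subgraph on $V(G)\setminus J$. The contraction $G/e$ of $e=\{u,v\}$ has vertex set $(V(G)\setminus\{u,v\})\cup\{w\}$ with $w$ a new vertex; its edges are the edges of $G$ disjoint from $e$ together with the edges $\{w,z\}$ for every $z\in V(G)\setminus\{u,v\}$ adjacent in $G$ to $u$ or $v$. *)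

(* Defs.v *)
From HB Require Import structures.
From mathcomp Require Import all_boot all_order all_algebra.
From mathcomp Require Import boolp.
From mathcomp Require Import mpoly.

Set Implicit Arguments.
Unset Strict Implicit.
Unset Printing Implicit Defensive.

Import GRing.Theory.
Local Open Scope ring_scope.

Record sgraph (V : finType) := SGraph {
  adj :> rel V;
  adj_sym : ssrbool.symmetric adj;
  adj_irr : irreflexive adj
}.

Section GraphOperations.
Variables (V : finType) (G : sgraph V).

Definition is_clique (J : {set V}) : Prop :=
  {in J &, forall x y, x != y -> G x y}.

Definition del_edge_rel (u v : V) : rel V :=
  fun x y => G x y && ([set x; y] != [set u; v]).

Fact del_edge_sym u v : ssrbool.symmetric (del_edge_rel u v).
Proof. by move=> x y; rewrite /del_edge_rel adj_sym setUC. Qed.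

Fact del_edge_irr u v : irreflexive (del_edge_rel u v).
Proof. by move=> x; rewrite /del_edge_rel adj_irr. Qed.

Definition del_edge (u v : V) : sgraph V :=
  SGraph (@del_edge_sym u v) (@del_edge_irr u v).

Definition del_set_rel (J : {set V}) : rel {x : V | x \notin J} :=
  fun x y => G (val x) (val y).

Fact del_set_sym J : ssrbool.symmetric (@del_set_rel J).
Proof. by move=> x y; rewrite /del_set_rel adj_sym. Qed.

Fact del_set_irr J : irreflexive (@del_set_rel J).
Proof. by move=> x; rewrite /del_set_rel adj_irr. Qed.

Definition del_set (J : {set V}) : sgraph {x : V | x \notin J} :=
  SGraph (@del_set_sym J) (@del_set_irr J).

(* [None] is the new vertex w. *)
Definition contract_vertex (u v : V) : finType :=
  option {x : V | x \notin [set u; v]}.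

Definition contract_rel (u v : V) : rel (contract_vertex u v) :=
  fun x y => match x, y with
  | Some x, Some y => G (val x) (val y)
  | None, Some z | Some z, None => G u (val z) || G v (val z)
  | None, None => false
  end.

Fact contract_sym u v : ssrbool.symmetric (@contract_rel u v).
Proof. by case=> [x|] [y|] //=; rewrite adj_sym. Qed.

Fact contract_irr u v : irreflexive (@contract_rel u v).
Proof. by case=> [x|] //=; rewrite adj_irr. Qed.

Definition contract (u v : V) : sgraph (contract_vertex u v) :=
  SGraph (@contract_sym u v) (@contract_irr u v).

End GraphOperations.

Section VNumber.
Variables (K : fieldType) (n : nat).
Local Notation R := {mpoly K[n]}.
Implicit Types I p : {pred R}.

(* (I : f), which is also the annihilator in R of the class of f in R/I. *)
Definition colon I (f : R) : {pred R} := [pred g | g * f \in I].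

(* [idealr_closed] includes that the ideal is proper. *)
Definition prime_ideal p : Prop := idealr_closed p /\ prime_idealr_closed p.

(* p is in Ass(R/I). *)
Definition associated_prime I p : Prop :=
  prime_ideal p /\ exists g : R, p =i colon I g.

Definition vnumber_attained I (d : nat) : Prop :=
  exists (f : R) (p : {pred R}),
    [/\ f \is d.-homog, associated_prime I p & colon I f =i p].

Fact vnumber_attained_asbool I :
  (exists d, vnumber_attained I d) -> exists d, `[< vnumber_attained I d >].
Proof. by case=> d Id; exists d; apply/asboolP. Qed.

(* The default value 0 is never used when I is a proper graded ideal, since
   Ass(R/I) is then nonempty and its members are annihilators of homogeneous
   elements. *)
Definition vnumber I : nat :=
  if pselect (exists d, vnumber_attained I d) is left ex_d
  then ex_minn (vnumber_attained_asbool ex_d) else 0%N.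

Lemma vnumberP I : (exists d, vnumber_attained I d) ->
  vnumber_attained I (vnumber I) /\
  forall d, vnumber_attained I d -> (vnumber I <= d)%N.
Proof.
move=> ex_d; rewrite /vnumber; case: pselect => // {}ex_d.
case: ex_minnP => m /asboolP Im m_min; split=> // d Id.
by apply/m_min/asboolP.
Qed.

End VNumber.

Section EdgeIdeal.
Variables (K : fieldType) (V : finType) (G : sgraph V).

(* K[V] is {mpoly K[#|V|]}, the vertex x being the variable number
   [enum_rank x]. *)
Definition vertex_var (x : V) : {mpoly K[#|V|]} := 'X_(enum_rank x).

Definition edge_ideal : {pred {mpoly K[#|V|]}} :=
  [pred f | `[< exists c : V -> V -> {mpoly K[#|V|]},
     f = \sum_x \sum_(y | G x y) c x y * (vertex_var x * vertex_var y) >]].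

End EdgeIdeal.

Arguments edge_ideal K {V} G.

(* Main.v *)
Require Import Defs.
From mathcomp Require Import all_boot all_order all_algebra.
From mathcomp Require Import boolp.
From mathcomp Require Import mpoly.

Set Implicit Arguments.
Unset Strict Implicit.
Unset Printing Implicit Defensive.

Import GRing.Theory.

(** The v-number of an edge ideal is combinatorial: v(I(G)) is the least size
    of a stable set A whose neighbourhood N(A) is a vertex cover (such sets
    are called stable dominators below).

    - If A is a stable dominator and x_A is the product of its variables, then
      a monomial m satisfies m * x_A \in I(G) iff the support of m meets N(A).
      So (I(G) : x_A) consists of the polynomials killed by x_i := 0 for
      i \in N(A); it is the kernel of a ring morphism to a domain, hence a
      prime, and v(I(G)) <= #|A| ([vnumber_le_card]).
    - If f is homogeneous and p = (I(G) : f) is prime, then p contains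
      I(G), so the vertices whose variable lies in p form a vertex cover.
      As 1 is not in p, some monomial m of f lies outside I(G), i.e., has a
      stable support A. For each variable x in p, x * f \in I(G) gives
      x * m \in I(G), and hence x has a neighbour in A. So A is a stable
      dominator, of size at most deg f ([attained_stable_dominator]).

    The three inequalities then follow by modifying an optimal A.
    For the deletion of an edge e, A is still stable, and it may fail to be a
    dominator only because e = {a, b} with a \in A and b adjacent to no other
    vertex of A; then b can be added to A.
    For a clique J, a stable dominator of G \ J is stable in G; when it does
    not dominate all of J, adding a single undominated vertex of J repairs
    this, since that vertex is adjacent to the rest of J.
    For the contraction, minimality of A provides a \in A with a private
    neighbour b, adjacent to no other vertex of A; the image of A in G / ab
    is then a stable dominator. *)

(** * Stable dominators *)

Section StableSets.
Variables (V : finType) (G : sgraph V).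
Implicit Types (A B C : {set V}) (x y : V).

Definition stable A := [forall x in A, forall y in A, ~~ G x y].

Definition nbhd A := [set y | [exists x in A, G x y]].

(** A set is a vertex cover exactly when its complement is stable. *)
Definition stable_dominator A := stable A && stable (~: nbhd A).

Lemma stableP A : reflect {in A &, forall x y, ~~ G x y} (stable A).
Proof.
apply: (iffP forall_inP) => [AP x y xA yA|AP x xA].
  by move/forall_inP: (AP x xA); apply.
by apply/forall_inP => y yA; apply: AP.
Qed.

Lemma stablePn A :
  reflect (exists x y, [/\ x \in A, y \in A & G x y]) (~~ stable A).
Proof.
apply: (iffP forall_inPn) => [[x xA]|[x [y [xA yA Gxy]]]].
  by case/forall_inPn => y yA /negPn Gxy; exists x, y.
by exists x => //; apply/forall_inPn; exists y; rewrite ?negbK.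
Qed.

Lemma stable_sub A B : A \subset B -> stable B -> stable A.
Proof.
move=> /subsetP sAB /stableP BP.
by apply/stableP => x y /sAB ? /sAB; apply: BP.
Qed.

Lemma stableCP C :
  reflect (forall x y, G x y -> (x \in C) || (y \in C)) (stable (~: C)).
Proof.
apply: (iffP (stableP _)) => [CP x y|CP x y].
  by apply: contraTT; rewrite negb_or -!in_setC => /andP[]; apply: CP.
by rewrite !inE => xC yC; apply/negP => /CP; rewrite (negPf xC) (negPf yC).
Qed.

Lemma nbhdP A y : reflect (exists2 x, x \in A & G x y) (y \in nbhd A).
Proof. by rewrite inE; apply: exists_inP. Qed.

Lemma nbhdU1 x A y : (y \in nbhd (x |: A)) = G x y || (y \in nbhd A).
Proof.
apply/nbhdP/orP => [[z /setU1P[->|zA] Gzy]|[Gxy|/nbhdP[z zA Gzy]]].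
- by left.
- by right; apply/nbhdP; exists z.
- by exists x => //; rewrite setU11.
- by exists z => //; rewrite setU1r.
Qed.

Lemma stable_nbhd A : stable A -> A \subset ~: nbhd A.
Proof.
move=> /stableP AP; apply/subsetP => y yA; rewrite inE.
by apply/nbhdP => -[x xA]; apply/negP/AP.
Qed.

Lemma stableU1 x A : stable A -> x \notin nbhd A -> stable (x |: A).
Proof.
move=> /stableP AP xA; apply/stableP => y z /setU1P[->|yA] /setU1P[->|zA].
- by rewrite adj_irr.
- by apply: contra xA => Gxz; apply/nbhdP; exists z; rewrite 1?adj_sym.
- by apply: contra xA => Gyx; apply/nbhdP; exists y.
- exact: AP.
Qed.

(** The repair step for edge deletion and for clique deletion: one new vertex
    absorbs all the edges that A leaves uncovered. *)
Lemma stable_dominatorU1 t A : stable A -> t \notin nbhd A ->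
    (forall x y, G x y -> [|| x \in nbhd A, y \in nbhd A, G t x | G t y]) ->
  stable_dominator (t |: A).
Proof.
move=> stA tA covA; apply/andP; split; first exact: stableU1.
apply/stableCP => x y /covA; rewrite !nbhdU1.
by case/or4P => ->; rewrite ?orbT.
Qed.

(** A maximal stable set dominates every vertex outside it. *)
Lemma exists_stable_dominator : exists A, stable_dominator A.
Proof.
have st0 : stable set0 by apply/stableP => x y; rewrite inE.
have [A maxA _] := maxset_exists st0; exists A.
rewrite /stable_dominator (maxsetp maxA).
apply: stable_sub (maxsetp maxA); apply/subsetP => x; rewrite inE => xA.
by rewrite -(maxsetsup maxA (stableU1 (maxsetp maxA) xA) (subsetUr _ _)) setU11.
Qed.

(** For B the support of a monomial m, this decides whether m lies in
    (I(G) : x_A). The complement of N(A) is itself stable and contains A, so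
    it bounds every stable set that extends A. *)
Lemma stableU_dominator A B : stable_dominator A ->
  stable (B :|: A) = [disjoint B & nbhd A].
Proof.
case/andP => stA stN; rewrite disjoints_subset.
apply/idP/idP => [/stableP ABP|sBN].
  apply/subsetP => y yB; rewrite inE; apply/nbhdP => -[x xA].
  by apply/negP/ABP; rewrite inE ?xA ?yB ?orbT.
by apply: stable_sub stN; rewrite subUset sBN stable_nbhd.
Qed.

(** Otherwise removing a from A would leave the neighbourhood unchanged, and
    hence give a smaller stable dominator. *)
Lemma private_neighbour A a :
    (forall B, stable_dominator B -> #|A| <= #|B|) ->
  stable_dominator A -> a \in A -> exists2 b, G a b & b \notin nbhd (A :\ a).
Proof.
move=> minA /andP[stA stN] aA.
pose private b := G a b && (b \notin nbhd (A :\ a)).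
have [b /andP[Gab bA]|noB] := pickP private; first by exists b.
have domAa : stable_dominator (A :\ a).
  rewrite /stable_dominator (stable_sub (subsetDl _ _) stA).
  apply: stable_sub stN; apply/subsetP => y; rewrite 2!in_setC.
  apply: contra => /nbhdP[x xA Gxy].
  have [xa|xa] := eqVneq x a; last first.
    by apply/nbhdP; exists x; rewrite // !inE xa.
  by have := noB y; rewrite /private -xa Gxy => /negbFE.
by have := minA _ domAa; rewrite (cardsD1 a A) aA ltnn.
Qed.

End StableSets.

(** * Monomials and edge ideals *)

Local Open Scope ring_scope.

Section EdgeIdealMonomials.
Variables (K : fieldType) (V : finType).
Local Notation R := {mpoly K[#|V|]}.
Local Notation mnm := 'X_{1.. #|V|}.
Implicit Types (A S : {set V}) (m : mnm) (f g : R).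

Definition mvars m : {set V} := [set x | m (enum_rank x) != 0%N].

Definition set_mnm A : mnm := [multinom (enum_val i \in A : nat) | i < #|V|].

Lemma mvarsD m1 m2 : mvars (m1 + m2)%MM = mvars m1 :|: mvars m2.
Proof. by apply/setP => x; rewrite !inE mnmDE addn_eq0 negb_and. Qed.

Lemma mvars_set_mnm A : mvars (set_mnm A) = A.
Proof. by apply/setP => x; rewrite inE mnmE enum_rankK; case: (x \in A). Qed.

Lemma mvars1 x : mvars U_(enum_rank x)%MM = [set x].
Proof.
apply/setP => y; rewrite !inE mnm1E (inj_eq enum_rank_inj) [x == y]eq_sym.
by case: (y == x).
Qed.

Lemma sum_vertices (F : 'I_#|V| -> nat) :
  (\sum_i F i = \sum_(x : V) F (enum_rank x))%N.
Proof. by rewrite (reindex _ (onW_bij _ (@enum_rank_bij V))). Qed.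

Lemma mdeg_set_mnm A : mdeg (set_mnm A) = #|A|.
Proof.
rewrite mdegE sum_vertices -sum1_card [RHS]big_mkcond.
by apply: eq_bigr => x _; rewrite mnmE enum_rankK; case: (x \in A).
Qed.

Lemma card_mvars m : (#|mvars m| <= mdeg m)%N.
Proof.
rewrite mdegE sum_vertices -sum1_card big_mkcond.
by apply: leq_sum => x _; rewrite inE; case: (m _).
Qed.

(** Setting the variables in S to 0. The monomial prime generated by S is the
    kernel of this substitution, which makes its primality immediate. *)
Definition kill S : R -> R :=
  comp_mpoly [tuple (if enum_val i \in S then 0 else 'X_i) | i < #|V|].

Lemma killX S m : kill S 'X_[m] = if [disjoint mvars m & S] then 'X_[m] else 0.
Proof.
rewrite /kill comp_mpolyX; case: ifP => [/pred0P dj|/negbT /pred0Pn[x]].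
  rewrite [RHS]mpolyXE_id; apply: eq_bigr => i _; rewrite tnth_mktuple.
  case: ifP => // iS; have := dj (enum_val i).
  by rewrite /= iS andbT inE enum_valK => /negbFE/eqP ->; rewrite !expr0.
rewrite /= inE => /andP[mx xS]; rewrite (bigD1 (enum_rank x)) //=.
by rewrite tnth_mktuple enum_rankK xS expr0n (negPf mx) mul0r.
Qed.

Lemma mcoeff_kill S f m :
  (kill S f)@_m = if [disjoint mvars m & S] then f@_m else 0.
Proof.
rewrite /kill comp_mpolyEX raddf_sum /=.
transitivity (\sum_(m' <- msupp f) if m' == m then
    (if [disjoint mvars m & S] then f@_m else 0) else 0).
  apply: eq_bigr => m' _; rewrite mcoeffZ -/(kill S _) killX.
  case: eqP => [->|/eqP/negPf ne]; case: ifP => _;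
    by rewrite ?mcoeffX ?mcoeff0 ?eqxx ?ne ?mulr1 ?mulr0.
rewrite -big_mkcond /=; have [mf|mf] := boolP (m \in msupp f).
  by rewrite -big_filter filter_pred1_uniq ?msupp_uniq // big_seq1.
by rewrite big1_seq ?memN_msupp_eq0 ?if_same // => m' /andP[_ _].
Qed.

Lemma kill_eq0P S f :
  reflect {in msupp f, forall m, ~~ [disjoint mvars m & S]} (kill S f == 0).
Proof.
apply: (iffP eqP) => [f0 m|fP].
  rewrite mcoeff_msupp; apply: contra => dj.
  by rewrite -[f@_m]/(if true then f@_m else 0) -dj -mcoeff_kill f0 mcoeff0.
apply/mpolyP => m; rewrite mcoeff_kill mcoeff0; case: ifP => // dj.
by apply: memN_msupp_eq0; apply: contraL dj => /fP.
Qed.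

Definition kill_ideal S : {pred R} := [pred g | kill S g == 0].

Lemma kill_prime S : prime_ideal (kill_ideal S).
Proof.
split; first split; rewrite ?inE /kill.
- by rewrite rmorph0.
- by rewrite rmorph1 oner_eq0.
- move=> a u v; rewrite !inE => /eqP u0 /eqP v0.
  by rewrite /kill rmorphD rmorphM /= -!/(kill S _) u0 v0 mulr0 addr0.
- by move=> u v; rewrite !inE /kill rmorphM mulf_eq0.
Qed.

Variable G : sgraph V.
Local Notation I := (edge_ideal K G).

Lemma edge_ideal0 : 0 \in I.
Proof.
apply/asboolP; exists (fun _ _ => 0); symmetry.
by do 2![apply: big1 => *]; rewrite mul0r.
Qed.

Lemma edge_idealD f g : f \in I -> g \in I -> f + g \in I.
Proof.
move=> /asboolP[c ->] /asboolP[d ->]; apply/asboolP.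
exists (fun x y => c x y + d x y); rewrite -big_split; apply: eq_bigr => x _.
by rewrite -big_split; apply: eq_bigr => y _; rewrite mulrDl.
Qed.

Lemma edge_in_edge_ideal x y h :
  G x y -> h * (vertex_var K x * vertex_var K y) \in I.
Proof.
move=> Gxy; apply/asboolP.
exists (fun x' y' => if (x' == x) && (y' == y) then h else 0).
rewrite (bigD1 x) //= (bigD1 y) //= !eqxx /=.
rewrite big1 => [|y' /andP[_ /negPf->]]; last by rewrite mul0r.
rewrite big1 ?addr0 // => x' /negPf->.
by rewrite big1 // => *; rewrite mul0r.
Qed.

(** The edge ideal is a monomial ideal, and a monomial lies in it when it is
    divisible by an edge. *)
Lemma edge_idealP f :
  reflect {in msupp f, forall m, ~~ stable G (mvars m)} (f \in I).
Proof.
apply: (iffP idP) => [/asboolP[c ->] m|fP].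
  rewrite mcoeff_msupp; apply: contra => /stableP st.
  rewrite raddf_sum big1 //= => x _; rewrite raddf_sum big1 //= => y Gxy.
  rewrite /vertex_var -mpolyXD; apply: memN_msupp_eq0.
  rewrite (perm_mem (msuppMX _ _)); apply/negP => /mapP[m' _ def_m].
  have xm : x \in mvars m by rewrite def_m !mvarsD !mvars1 !inE eqxx.
  have ym : y \in mvars m by rewrite def_m !mvarsD !mvars1 !inE eqxx orbT.
  by move: (st x y xm ym); rewrite Gxy.
rewrite [f]mpolyE big_seq; apply: (big_ind (fun g => g \in I)) => [||m /fP].
- exact: edge_ideal0.
- exact: edge_idealD.
case/stablePn => x [y [xm ym Gxy]].
have xy : x != y by apply: contraTneq Gxy => ->; rewrite adj_irr.
have le_m : (U_(enum_rank x) + U_(enum_rank y) <= m)%MM.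
  apply/mnm_lepP => i; rewrite mnmDE !mnm1E.
  move: xm ym; rewrite !inE -!lt0n => xm ym.
  case: eqP => [<-|_]; first by rewrite (inj_eq enum_rank_inj) eq_sym (negPf xy).
  by case: eqP => [<-|].
rewrite -(submK le_m) mpolyXD mpolyXD scalerAl.
exact: edge_in_edge_ideal.
Qed.

(** Both sides are spanned by monomials, so membership is compared one
    monomial at a time. *)
Lemma colon_set_mnm A : stable_dominator G A ->
  colon I 'X_[set_mnm A] =i kill_ideal (nbhd G A).
Proof.
move=> domA g; rewrite !inE; apply/edge_idealP/kill_eq0P => gP m.
  move=> mg; rewrite -stableU_dominator // -{1}(mvars_set_mnm A) -mvarsD addmC.
  by apply: gP; rewrite (perm_mem (msuppMX _ _)) map_f.
rewrite (perm_mem (msuppMX _ _)) => /mapP[m' /gP m'P ->].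
by rewrite mvarsD mvars_set_mnm setUC stableU_dominator.
Qed.

Lemma stable_dominator_attained A :
  stable_dominator G A -> vnumber_attained I #|A|.
Proof.
move=> domA; exists 'X_[set_mnm A], (kill_ideal (nbhd G A)).
split; first by rewrite dhomogX /= mdeg_set_mnm.
  split; first exact: kill_prime.
  by exists 'X_[set_mnm A] => g; rewrite colon_set_mnm.
exact: colon_set_mnm.
Qed.

(** A single monomial of f is enough: p itself is not known to be monomial,
    but its variables form a vertex cover, and each of them multiplies every
    monomial of f into the edge ideal. *)
Lemma attained_stable_dominator d : vnumber_attained I d ->
  exists2 A, stable_dominator G A & (#|A| <= d)%N.
Proof.
case=> f [p [fd [[[[_ p1 _] p_prime] _] fp]]].
have /hasP[m mf] : has (fun m => stable G (mvars m)) (msupp f).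
  rewrite -[has _ _]negbK -all_predC; apply: contra p1 => /allP fP.
  by rewrite -fp inE mul1r; apply/edge_idealP.
move=> stm; exists (mvars m); last first.
  by rewrite -(dhomogP _ _ _ fd m mf) card_mvars.
have var_nbhd x : vertex_var K x \in p -> x \in nbhd G (mvars m).
  rewrite -fp inE mulrC => /edge_idealP /(_ (U_(enum_rank x) + m)%MM).
  rewrite (perm_mem (msuppMX _ _)) map_f // mvarsD mvars1 => /(_ isT).
  by apply: contraR; apply: stableU1.
rewrite /stable_dominator stm; apply/stableCP => x y Gxy.
have : vertex_var K x * vertex_var K y \in p.
  rewrite -fp inE mulrC; exact: edge_in_edge_ideal.
by case/p_prime/orP => /var_nbhd ->; rewrite ?orbT.
Qed.

Lemma vnumber_le_card A : stable_dominator G A -> (vnumber I <= #|A|)%N.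
Proof.
move/stable_dominator_attained => Aatt.
by have [_] := vnumberP (ex_intro _ _ Aatt); apply.
Qed.

Lemma vnumber_card : exists2 A, stable_dominator G A & #|A| = vnumber I.
Proof.
have [B /stable_dominator_attained Batt] := exists_stable_dominator G.
have [/attained_stable_dominator[A domA leA] _] := vnumberP (ex_intro _ _ Batt).
by exists A => //; apply/eqP; rewrite eqn_leq leA vnumber_le_card.
Qed.

End EdgeIdealMonomials.

Local Close Scope ring_scope.

(** * Effect of the graph operations on stable dominators *)

Section Operations.
Variables (V : finType) (G : sgraph V).
Implicit Types (A J : {set V}).

(** If A stops dominating, the removed edge joins some a in A to a vertex t
    with no other neighbour in A, and t is the vertex to add. *)
Lemma stable_dominator_del_edge u v A : stable_dominator G A ->
  exists2 B, stable_dominator (del_edge G u v) B & #|B| <= #|A|.+1.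
Proof.
case/andP => /stableP stA /stableCP covA; set G' := del_edge G u v.
have G'G x y : G' x y -> G x y by case/andP.
have stA' : stable G' A.
  by apply/stableP => x y xA yA; apply: contra (G'G x y) (stA x y xA yA).
have [domA|] := boolP (stable G' (~: nbhd G' A)).
  by exists A; rewrite ?leqnSn // /stable_dominator stA' domA.
case/stablePn => x0 [y0 []]; rewrite !in_setC => x0A y0A /G'G/covA covxy.
have [t [tA tA']] : exists t, t \in nbhd G A /\ t \notin nbhd G' A.
  by case/orP: covxy => ?; [exists x0 | exists y0].
have G'F c z : G c z -> ~~ G' c z -> [set c; z] = [set u; v].
  by rewrite /= /del_edge_rel => -> /negbNE/eqP.
have [a aA Gat] := nbhdP _ _ _ tA.
have G'at : ~~ G' a t by apply: contra tA' => ?; apply/nbhdP; exists a.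
(* The removed edge is at, and t is the only vertex that lost its domination. *)
have lost z : z \in nbhd G A -> z != t -> z \in nbhd G' A.
  case/nbhdP => c cA Gcz zt; apply/nbhdP; exists c => //.
  apply: contraT => /(G'F _ _ Gcz); rewrite -(G'F _ _ Gat G'at) => eq_e.
  have : z \in [set a; t] by rewrite -eq_e set22.
  rewrite !inE (negPf zt) orbF => /eqP za.
  by move: Gcz; rewrite za (negPf (stA _ _ cA aA)).
exists (t |: A); last by rewrite cardsU1; case: (t \notin A).
apply: stable_dominatorU1 => // x y G'xy.
have [xt|xt] := eqVneq x t; first by rewrite -xt G'xy !orbT.
have [yt|yt] := eqVneq y t; first by rewrite -yt [G' y x]adj_sym G'xy !orbT.
by case/orP: (covA _ _ (G'G _ _ G'xy)) => /lost -> //; rewrite ?orbT.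
Qed.

(** Any undominated vertex of J, once added, dominates the rest of J, so one
    additional vertex is enough. *)
Lemma stable_dominator_clique J (A : {set {x : V | x \notin J}}) :
    is_clique G J -> stable_dominator (del_set G J) A ->
  exists2 B, stable_dominator G B & #|B| <= #|A|.+1.
Proof.
move=> clJ /andP[/stableP stA /stableCP covA].
pose A' := [set val x | x in A].
have cardA' : #|A'| = #|A| by rewrite card_imset //; apply: val_inj.
have stA' : stable G A'.
  by apply/stableP => _ _ /imsetP[x xA ->] /imsetP[y yA ->]; apply: stA.
have nbhdA' z : z \in nbhd (del_set G J) A -> val z \in nbhd G A'.
  by case/nbhdP => x xA Gxz; apply/nbhdP; exists (val x); rewrite ?imset_f.
have covA' x y : x \notin J -> y \notin J -> G x y ->
    (x \in nbhd G A') || (y \in nbhd G A').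
  move=> xJ yJ Gxy; have := covA (Sub x xJ) (Sub y yJ).
  rewrite /= /del_set_rel !SubK => /(_ Gxy).
  by case/orP => /nbhdA'; rewrite SubK => ->; rewrite ?orbT.
have [JA|/subsetPn[t tJ tA]] := boolP (J \subset nbhd G A').
  exists A'; last by rewrite cardA'.
  rewrite /stable_dominator stA'; apply/stableCP => x y Gxy.
  have [/(subsetP JA)->//|xJ] := boolP (x \in J).
  have [/(subsetP JA)->|yJ] := boolP (y \in J); first by rewrite orbT.
  exact: covA'.
exists (t |: A'); last by rewrite cardsU1 cardA'; case: (t \notin A').
apply: stable_dominatorU1 => // x y Gxy.
have [xt|xt] := eqVneq x t; first by rewrite -xt Gxy !orbT.
have [yt|yt] := eqVneq y t; first by rewrite -yt [G y x]adj_sym Gxy !orbT.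
have [xJ|xJ] := boolP (x \in J); first by rewrite (clJ t x) ?orbT // eq_sym.
have [yJ|yJ] := boolP (y \in J); first by rewrite (clJ t y) ?orbT // eq_sym.
by case/orP: (covA' _ _ xJ yJ Gxy) => ->; rewrite ?orbT.
Qed.

(** Contracting ab keeps the image of A stable because b has no neighbour in
    A other than a. *)
Lemma stable_dominator_contract A a b :
    stable_dominator G A -> a \in A -> G a b -> b \notin nbhd G (A :\ a) ->
  exists2 B, stable_dominator (contract G a b) B & #|B| <= #|A|.
Proof.
case/andP => /stableP stA /stableCP covA aA Gab bA.
pose T := {x : V | x \notin [set a; b]}.
pose B : {set option T} := [set insub x | x in A].
(* The contraction map is [insub]: it sends exactly a and b to None. *)
exists B; last exact: leq_imset_card.
have bNA : b \notin A by apply: contraL Gab => bA'; apply: stA.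
have BSome (x : T) : (Some x \in B) = (val x \in A).
  apply/imsetP/idP => [[y yA]|xA]; last by exists (val x); rewrite ?valK.
  by case: insubP yA => // z _ <- zA [->].
have BNone : None \in B.
  by apply/imsetP; exists a; rewrite // insubF // !inE eqxx.
have Na (x : T) : val x \in A -> ~~ G a (val x) && ~~ G b (val x).
  move=> xA; rewrite stA //=; apply: contra bA => Gbx.
  apply/nbhdP; exists (val x); last by rewrite adj_sym.
  by have := valP x; rewrite !inE negb_or xA andbT => /andP[].
apply/andP; split.
  apply/stableP => -[x|] [y|]; rewrite ?BSome //= => xB yB.
  - exact: stA.
  - by rewrite negb_or Na.
  - by rewrite negb_or Na.
have nbhdB (x : T) : val x \in nbhd G A -> Some x \in nbhd (contract G a b) B.
  case/nbhdP => c cA Gcx; apply/nbhdP.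
  have [cab|cab] := boolP (c \in [set a; b]); last first.
    by exists (Some (Sub c cab)); rewrite ?BSome /= ?SubK.
  exists None => //=; case/set2P: cab cA Gcx => -> ; last by rewrite (negPf bNA).
  by move=> _ ->.
apply/stableCP => -[x|] [y|] //=.
- by case/covA/orP => /nbhdB ->; rewrite ?orbT.
- by move=> Gx; apply/orP; left; apply/nbhdP; exists None.
- by move=> Gy; apply/orP; right; apply/nbhdP; exists None.
Qed.

End Operations.

Theorem proposition4p2 (K : fieldType) (V : finType) (G : sgraph V) :
  [/\ forall u v : V, G u v ->
        (vnumber (edge_ideal K (del_edge G u v))
           <= vnumber (edge_ideal K G) + 1)%N,
      forall J : {set V}, is_clique G J ->
        (vnumber (edge_ideal K G)
           <= vnumber (edge_ideal K (del_set G J)) + 1)%N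
    & (exists u v : V, G u v) ->
      exists u v : V, G u v /\
        (vnumber (edge_ideal K (contract G u v))
           <= vnumber (edge_ideal K G))%N].
Proof.
have [A domA cardA] := vnumber_card K G; split.
- move=> u v _; rewrite -cardA addn1.
  have [B domB leB] := stable_dominator_del_edge u v domA.
  exact: leq_trans (vnumber_le_card K domB) leB.
- move=> J clJ; have [C domC <-] := vnumber_card K (del_set G J).
  have [B domB leB] := stable_dominator_clique clJ domC.
  by rewrite addn1; exact: leq_trans (vnumber_le_card K domB) leB.
- case=> u [v Guv].
  have [a aA] : exists a, a \in A.
    case/andP: domA => _ /stableCP /(_ _ _ Guv).
    by case/orP => /nbhdP[a aA _]; exists a.
  have minA B : stable_dominator G B -> #|A| <= #|B|.
    by rewrite cardA; apply: vnumber_le_card.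
  have [b Gab bA] := private_neighbour minA domA aA.
  exists a, b; split=> //; rewrite -cardA.
  have [B domB leB] := stable_dominator_contract domA aA Gab bA.
  exact: leq_trans (vnumber_le_card K domB) leB.
Qed.
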